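(* Let $S$ be a finite set, $X$ a set, and $\geq$ a relation on $X^S$ satisfying axioms P'1, P2, P3, P4, P5', L and U. Then the nonmonotonic inference $A\mathrel{|\!\sim}B\Leftrightarrow A\cap B>A\cap\bar B$, built from the relation on events projected from $X^S$ to $2^S$, satisfies the properties of system P; that is, for all $A,B,C\subseteq S$: (RR) $A>\emptyset\Rightarrow A\mathrel{|\!\sim}A$; (AND) $A\cap C>A\cap\bar C$ and $A\cap B>A\cap\bar B$ imply $A\cap B\cap C>A\cap(\bar C\cup\bar B)$; (OR) $A\cap C>A\cap\bar C$ and $B\cap C>B\cap\bar C$ imply $(A\cup B)\cap C>(A\cup B)\cap\bar C$; (RW) $B\subseteq C$ and $A\cap B>A\cap\bar B$ imply $A\cap C>A\cap\bar C$; (CM) $A\cap B>A\cap\bar B$ and $A\cap C>A\cap\bar C$ imply $A\cap B\cap C>A\cap B\cap\bar C$; (CUT) $A\cap B>A\cap\bar B$ and $A\cap B\cap C>A\cap B\cap\bar C$ imply $A\cap C>A\cap\bar C$.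
   Context: Acts are maps $f:S\to X$. For a relation $\geq$ on $X^S$: $f\sim g$ iff $f\geq g$ and $g\geq f$; $f>g$ iff $f\geq g$ and not $g\geq f$. For $A\subseteq S$, $\bar A=S\setminus A$ and $f_{|A}\cup g_{|\bar A}$ is the act equal to $f$ on $A$ and $g$ on $\bar A$. $f\geq_A g$ iff for all acts $h$, $f_{|A}\cup h_{|\bar A}\geq g_{|A}\cup h_{|\bar A}$; $f\sim_A g$ iff $f\geq_A g$ and $g\geq_A f$. $A$ is null iff $f\geq_A g$ for all acts $f,g$. $f_x$ denotes the constant act with value $x\in X$; $x\geq y$ means $f_x\geq f_y$ (and $x>y$, $x\sim y$ accordingly). For $x>y$ and $C\subseteq S$, $\omega(C)^{x,y}$ is the act equal to $x$ on $C$ and $y$ on $\bar C$. For events $A,B\subseteq S$: $A\geq B$ iff $\omega(A)^{x,y}\geq\omega(B)^{x,y}$ for all $x>y$ in $X$; $A>B$ iff $A\geq B$ and not $B\geq A$. $[f\geq g]=\{s\in S: f(s)\geq g(s)\}$. Axioms: P'1: $\geq$ is complete on $X^S$; $>$ is transitive and irreflexive; $\sim$ is symmetric and reflexive. P2: for all $A\subseteq S$ and acts $f,g,h,h'$: $f_{|A}\cup h_{|\bar A}\geq g_{|A}\cup h_{|\bar A}\Leftrightarrow f_{|A}\cup h'_{|\bar A}\geq g_{|A}\cup h'_{|\bar A}$. P3: for all non-null $A\subseteq S$ and $x,y\in X$: $f_x\geq_A f_y\Leftrightarrow x\geq y$. P4: for all $A,B\subseteq S$ and $x>y$, $x'>y'$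 in $X$: $\omega(A)^{x,y}\geq\omega(B)^{x,y}\Leftrightarrow\omega(A)^{x',y'}\geq\omega(B)^{x',y'}$. P5': there are $x,y,z\in X$ with $x>y>z$. L: for all acts $f,g$: $f\geq g\Leftrightarrow[f\geq g]\geq[g\geq f]$ (comparison of events). U: for all acts $f,g$ and $A\subseteq S$: $f\geq_A g$ and $f\sim_{\bar A}g$ imply $f\geq g$. *)

(* Defs.v *)
From mathcomp Require Import all_boot.
From mathcomp Require Import mathcomp_extra boolp classical_sets functions.

Set Implicit Arguments.
Unset Strict Implicit.
Unset Printing Implicit Defensive.

Local Open Scope classical_set_scope.

Definition strict {T : Type} (r : T -> T -> Prop) (a b : T) : Prop :=
  r a b /\ ~ r b a.

Definition indiff {T : Type} (r : T -> T -> Prop) (a b : T) : Prop :=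
  r a b /\ r b a.

(* Acts are functions [S -> X], events are terms of type [set S]. The act
   written f_|A u h_|~A on paper is [patch h A f]: it is f on A and h
   outside A. *)

Section Preference.
Context {S X : Type}.
Variable geq : (S -> X) -> (S -> X) -> Prop.

Definition outcome_ge (x y : X) : Prop := geq (cst x) (cst y).

Definition ge_on (A : set S) (f g : S -> X) : Prop :=
  forall h : S -> X, geq (patch h A f) (patch h A g).

Definition null_event (A : set S) : Prop := forall f g : S -> X, ge_on A f g.

Definition bet (x y : X) (C : set S) : S -> X := patch (cst y) C (cst x).

Definition event_ge (A B : set S) : Prop :=
  forall x y : X, strict outcome_ge x y -> geq (bet x y A) (bet x y B).

Definition ge_set (f g : S -> X) : set S := [set s | outcome_ge (f s) (g s)].

Definition infers (A B : set S) : Prop :=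
  strict event_ge (A `&` B) (A `&` ~` B).

Definition axiom_P1' : Prop :=
  [/\ forall f g, geq f g \/ geq g f,
      forall f g h, strict geq f g -> strict geq g h -> strict geq f h,
      forall f, ~ strict geq f f,
      forall f g, indiff geq f g -> indiff geq g f
    & forall f, indiff geq f f].

Definition axiom_P2 : Prop :=
  forall (A : set S) (f g h h' : S -> X),
    geq (patch h A f) (patch h A g) <-> geq (patch h' A f) (patch h' A g).

Definition axiom_P3 : Prop :=
  forall A : set S, ~ null_event A ->
    forall x y : X, ge_on A (cst x) (cst y) <-> outcome_ge x y.

Definition axiom_P4 : Prop :=
  forall (A B : set S) (x y x' y' : X),
    strict outcome_ge x y -> strict outcome_ge x' y' ->
    (geq (bet x y A) (bet x y B) <-> geq (bet x' y' A) (bet x' y' B)).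

Definition axiom_P5' : Prop :=
  exists x y z : X, strict outcome_ge x y /\ strict outcome_ge y z.

Definition axiom_L : Prop :=
  forall f g : S -> X, geq f g <-> event_ge (ge_set f g) (ge_set g f).

Definition axiom_U : Prop :=
  forall (f g : S -> X) (A : set S),
    ge_on A f g -> indiff (ge_on (~` A)) f g -> geq f g.

End Preference.

(* Main.v *)
Require Import Defs.
From mathcomp Require Import all_boot.
From mathcomp Require Import mathcomp_extra boolp classical_sets functions.

Local Open Scope classical_set_scope.

(** By P2, comparing two events amounts to comparing their differences, so
    axiom L turns a strict preference between acts [f > g] into a strict
    comparison of the events where [f] beats [g] and where [g] beats [f].
    Transitivity of [>] on acts built from three outcomes [x > y > z] then
    gives two facts about disjoint events: [>] is preserved by enlarging
    the left event and shrinking the right one, and [P u Q > R], [P u R > Q]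
    imply [P > Q u R].  System P follows from these two. *)

Section PreferenceOnEvents.
Context {S X : Type} {geq : (S -> X) -> (S -> X) -> Prop}.

Local Notation "A >=e B" := (event_ge geq A B) (at level 70).
Local Notation "A >e B" := (strict (event_ge geq) A B) (at level 70).
Local Notation "x >o y" := (strict (outcome_ge geq) x y) (at level 70).

Context (hP1 : axiom_P1' geq) (hP2 : axiom_P2 geq) (hP3 : axiom_P3 geq)
  (hP4 : axiom_P4 geq) (hP5 : axiom_P5' geq) (hL : axiom_L geq)
  (hU : axiom_U geq).

Lemma event_geE (x y : X) (A B : set S) : x >o y ->
  (A >=e B) <-> geq (bet x y A) (bet x y B).
Proof.
move=> xy; split=> [|AB x' y' xy']; first exact.
by apply/(hP4 A B x y x' y' xy xy').
Qed.

Lemma patch_asboolE (h f : S -> X) (A : set S) (s : S) :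
  patch h A f s = if `[< A s >] then f s else h s.
Proof. by []. Qed.

(** Both bets pay [x] on the intersection of [A] and [B]; P2 replaces this common prize by [y],
    leaving bets on the two differences. *)
Lemma event_ge_setD (A B : set S) : (A >=e B) <-> (A `\` B >=e B `\` A).
Proof.
have [x [y [_ [xy _]]]] := hP5.
rewrite !(event_geE x y) //.
have split_bet (D E : set S) :
    bet x y D = patch (cst x) (~` (D `&` E)) (bet x y D) /\
    bet x y (D `\` E) = patch (cst y) (~` (D `&` E)) (bet x y D).
  split; apply/funext=> s; rewrite /bet !patch_asboolE /setI /setC /setD /=;
    do !case: asboolP => ?; by intuition.
have [eA eAB] := split_bet A B; have [eB eBA] := split_bet B A.
rewrite eAB eBA {1}eA {1}eB (setIC B A); exact: hP2.
Qed.

Lemma geq_gt_sets (f g : S -> X) :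
  geq f g <-> ([set s | f s >o g s] >=e [set s | g s >o f s]).
Proof.
(* Unfolded, the difference of [ge_set f g] and [ge_set g f] is the event where [f] is strictly
   better. *)
by rewrite hL event_ge_setD.
Qed.

Lemma strict_geq_gt_sets (f g : S -> X) :
  strict geq f g <-> ([set s | f s >o g s] >e [set s | g s >o f s]).
Proof. by rewrite /strict !geq_gt_sets. Qed.

(* Levels 2, 1, 0 stand for the three outcomes of P5'. *)
Lemma strict_event_level_trans (p q r : S -> nat) :
    (forall s, [&& p s <= 2, q s <= 2 & r s <= 2]) ->
    ([set s | q s < p s] >e [set s | p s < q s]) ->
    ([set s | r s < q s] >e [set s | q s < r s]) ->
  ([set s | r s < p s] >e [set s | p s < r s]).
Proof.
have [_ trans _ _ _] := hP1.
have [x [y [z [xy yz]]]] := hP5.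
have xz : x >o z by exact: trans xy yz.
pose v n : X := nth x [:: z; y; x] n.
have asym a b : a >o b -> ~ (b >o a) by case=> ? ? [].
have vE i j : (i <= 2) -> (j <= 2) -> (v i >o v j) = (j < i) :> Prop.
  move=> i2 j2; apply/propext.
  case: i i2 => [|[|[|]]] //= _; case: j j2 => [|[|[|]]] //= _;
    by split=> //; first [by case | by move=> /asym []].
move=> le2.
(* By [vE], [v] turns level functions into acts with the same strict comparisons, so transitivity on
   acts passes to events. *)
have E (a b : S -> nat) : (forall s, a s <= 2) -> (forall s, b s <= 2) ->
    strict geq (v \o a) (v \o b) <->
    ([set s | b s < a s] >e [set s | a s < b s]).
  move=> a2 b2; rewrite strict_geq_gt_sets.
  rewrite (_ : [set s | _] = [set s | b s < a s]); last first.
    by apply/funext => s; exact: vE.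
  rewrite (_ : [set s | (v \o b) s >o (v \o a) s] = [set s | a s < b s]) //.
  by apply/funext => s; exact: vE.
have p2 s : p s <= 2 by case/and3P: (le2 s).
have q2 s : q s <= 2 by case/and3P: (le2 s).
have r2 s : r s <= 2 by case/and3P: (le2 s).
rewrite -!E //; exact: trans.
Qed.

Lemma null_event_sub (A B : set S) : A `<=` B -> null_event geq B ->
  null_event geq A.
Proof.
move=> AB nB f g h.
have E (k : S -> X) : patch h A k = patch h B (patch h A k).
  apply/funext => s; rewrite /patch; case: ifPn => // sA.
    by rewrite ifT //; move: sA; rewrite !inE; exact: AB.
  by case: ifP.
rewrite (E f) (E g); exact: nB.
Qed.

Lemma bet_set0 (x y : X) : bet x y (@set0 S) = cst y.
Proof. by apply/funext => s; rewrite /bet patch_asboolE asboolF. Qed.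

(** P3 makes [x] strictly better than [y] conditionally on [A]; with [y] paid off [A], this compares
    the bet on [A] with the constant [y]. *)
Lemma nonnull_gt_set0 (A : set S) : ~ null_event geq A -> A >e set0.
Proof.
move=> nA; have [x [y [_ [[xy nyx] _]]]] := hP5.
rewrite /strict !(event_geE x y) // bet_set0.
have E : cst y = patch (cst y) A (cst y).
  by apply/funext=> s; rewrite /patch; case: ifP.
rewrite {1 2}E; split; first by have /(hP3 _ nA) := xy; apply.
by move=> yx; apply: nyx; apply/(hP3 _ nA) => h; apply/(hP2 _ _ _ h (cst y)).
Qed.

Lemma event_ge_set0 (A : set S) : A >=e set0.
Proof.
have [nA x y xy|/nonnull_gt_set0[//]] := EM (null_event geq A).
rewrite bet_set0.
have := nA (cst x) (cst y) (cst y); congr geq.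
by apply/funext=> s; rewrite /patch; case: ifP.
Qed.

(** If [A] were null, the bets on [A] and [B] would be indifferent on [A], while off [A] they reduce
    to bets on the empty set and on [B] minus [A]; U then yields [B >=e A]. *)
Lemma strict_event_nonnull (A B : set S) : A >e B -> ~ null_event geq A.
Proof.
move=> [_ nBA] nA; apply: nBA => x y xy.
apply: (hU (bet x y B) (bet x y A) (~` A)); last by rewrite setCK; split; exact: nA.
move=> h; apply/(hP2 _ _ _ h (cst y)).
have -> : patch (cst y) (~` A) (bet x y B) = bet x y (B `\` A).
  by apply/funext => s; rewrite /bet !patch_asboolE /setC /setD /=;
    do !case: asboolP => ?; intuition.
have -> : patch (cst y) (~` A) (bet x y A) = bet x y set0.
  by apply/funext => s; rewrite /bet !patch_asboolE /setC /set0 /=;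
    do !case: asboolP => ?; intuition.
exact: event_ge_set0.
Qed.

Lemma lt_setE (a b : S -> nat) (C : set S) :
  (forall s, a s < b s <-> C s) -> [set s | a s < b s] = C.
Proof. by move=> h; apply/funext => s; exact/propext/h. Qed.

Lemma strict_event_mono (U V U' V' : set S) :
    U `<=` U' -> V' `<=` V -> U `&` V `<=` set0 -> U' `&` V' `<=` set0 ->
  U >e V -> U' >e V'.
Proof.
move=> UU' V'V UV UV' gtUV.
(* This event contains [U], which is non-null because it beats [V]. *)
have gt0 : U' `|` V `\` V' >e set0.
  apply: nonnull_gt_set0 => /(null_event_sub U _)N.
  by apply: (strict_event_nonnull _ _ gtUV); apply: N => s Us; left; exact: UU'.
(* [q] is chosen so that [p > q] by U > V, and [q > r] because the event
   [q > r] contains U while the event [r > q] is empty. *)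
pose p s := if `[< U s >] then 2 else if `[< V s >] then 1 else
  if `[< U' s >] then 2 else 0.
pose q s := if `[< U s >] then 1 else if `[< V s >] then 2 else
  if `[< U' s >] then 2 else 0.
pose r s := if `[< U' s >] then 0 else if `[< V' s >] then 2 else
  if `[< V s >] then 1 else 0.
have := strict_event_level_trans p q r.
rewrite (lt_setE q p U) 1?(lt_setE p q V) 1?(lt_setE r q (U' `|` V `\` V'))
   1?(lt_setE q r set0) 1?(lt_setE r p U') 1?(lt_setE p r V').
  by apply=> // s; rewrite /p /q /r; do !case: asboolP => ?.
all: move=> s; have := UU' s; have := V'V s; have := UV s; have := UV' s.
all: rewrite /p /q /r /setI /setD /setU /set0 /=.
all: case: (asboolP (U s)) => ?; case: (asboolP (V s)) => ?;
  case: (asboolP (U' s)) => ?; case: (asboolP (V' s)) => ? /=; rewrite ?ltnn /=;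
  try by intuition.
Qed.

(** A Condorcet profile: three acts whose levels on [P], [Q], [R] are the cyclic shifts of 2, 1, 0.
    The two hypotheses rank the first above the second and the second above the third. *)
Lemma strict_event_setU (P Q R : set S) :
    P `&` Q `<=` set0 -> P `&` R `<=` set0 -> Q `&` R `<=` set0 ->
  P `|` Q >e R -> P `|` R >e Q -> P >e Q `|` R.
Proof.
move=> PQ PR QR.
pose lvl (i j k : nat) s := if `[< P s >] then i else if `[< Q s >] then j else
  if `[< R s >] then k else 0.
have := strict_event_level_trans (lvl 2 1 0) (lvl 1 0 2) (lvl 0 2 1).
rewrite (lt_setE (lvl 1 0 2) _ (P `|` Q)) 1?(lt_setE (lvl 2 1 0) _ R)
   1?(lt_setE (lvl 0 2 1) _ (P `|` R)) 1?(lt_setE (lvl 1 0 2) _ Q)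
   1?(lt_setE (lvl 0 2 1) _ P) 1?(lt_setE (lvl 2 1 0) _ (Q `|` R)).
  by apply=> // s; rewrite /lvl; do !case: asboolP => ?.
all: move=> s; have := PQ s; have := PR s; have := QR s.
all: rewrite /lvl /setI /setU /set0 /=.
all: case: (asboolP (P s)) => ?; case: (asboolP (Q s)) => ?;
  case: (asboolP (R s)) => ? /=; try by intuition.
Qed.

End PreferenceOnEvents.

Theorem mainTheorem12 (S : finType) (X : Type)
    (geq : (S -> X) -> (S -> X) -> Prop)
    (hP1 : axiom_P1' geq) (hP2 : axiom_P2 geq) (hP3 : axiom_P3 geq)
    (hP4 : axiom_P4 geq) (hP5 : axiom_P5' geq) (hL : axiom_L geq)
    (hU : axiom_U geq) :
  forall A B C : set S,
  (* RR *)  (strict (event_ge geq) A set0 -> infers geq A A) /\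
  (* AND *) (infers geq A C -> infers geq A B ->
      strict (event_ge geq) (A `&` B `&` C) (A `&` (~` C `|` ~` B))) /\
  (* OR *)  (infers geq A C -> infers geq B C -> infers geq (A `|` B) C) /\
  (* RW *)  (B `<=` C -> infers geq A B -> infers geq A C) /\
  (* CM *)  (infers geq A B -> infers geq A C -> infers geq (A `&` B) C) /\
  (* CUT *) (infers geq A B -> infers geq (A `&` B) C -> infers geq A C).
Proof.
have mono := strict_event_mono hP1 hP2 hP3 hP4 hP5 hL hU.
have join := strict_event_setU hP1 hP2 hP4 hP5 hL.
move=> A B C.
(* Supplying excluded middle for each event lets [tauto] decide Boolean inclusions. *)
have sub (D E : set S) : (forall s, (A s \/ ~ A s) -> (B s \/ ~ B s) ->
    (C s \/ ~ C s) -> D s -> E s) -> D `<=` E.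
  by move=> h s; apply: h; exact: EM.
(* Common core of AND, CM and CUT: [join] on the three pieces of [A] cut out by [B] and by [C]
   inside [B]. *)
have dec : infers geq A B -> strict (event_ge geq) (A `&` B `&` C `|` A `&` ~` B)
      (A `&` B `&` ~` C) ->
    strict (event_ge geq) (A `&` B `&` C) (A `&` B `&` ~` C `|` A `&` ~` B).
  move=> AB ABC; apply: join ABC; try by apply: sub => s /=; tauto.
  by apply: mono AB; apply: sub => s /=; tauto.
split; [|split; [|split; [|split; [|split]]]].
- by apply: mono; apply: sub => s /=; tauto.
- move=> AC AB; apply: (mono) (dec AB _); try by apply: sub => s /=; tauto.
  by apply: mono AC; apply: sub => s /=; tauto.
- move=> AC BC.
  (* The part of the union outside [C] is split into disjoint pieces, as [join] requires; each
     premise weakens to one of its two hypotheses. *)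
  have : strict (event_ge geq) ((A `|` B) `&` C)
      ((B `&` ~` C) `|` (A `&` ~` C `&` ~` B)).
    apply: join; try by apply: sub => s /=; tauto.
      by apply: mono AC; apply: sub => s /=; tauto.
    by apply: mono BC; apply: sub => s /=; tauto.
  by apply: mono; apply: sub => s /=; tauto.
- move=> BC; apply: mono; apply: sub => s /=; have := BC s; tauto.
- move=> AB AC; apply: (mono) (dec AB _); try by apply: sub => s /=; tauto.
  by apply: mono AC; apply: sub => s /=; tauto.
- move=> AB ABC; apply: (mono) (dec AB _); try by apply: sub => s /=; tauto.
  by apply: mono ABC; apply: sub => s /=; tauto.
Qed.
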